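(* Let $m\ge 2$ be a fixed integer, $r=m-1$, and let $s$ be a fixed real number with $0\le s<r$. For each integer $k\ge 2$ let $\mathcal{D}=[k]^m$, let $\Pr(\cdot)$ be the uniform distribution on $\mathcal{D}$, and let $\mathcal{D}^c\subseteq\mathcal{D}$ be a random subset containing each element of $\mathcal{D}$ independently with probability $p=\frac{1}{k^{r-s}}$. Let $\Pr(\cdot\mid C)$ and $\Pr(\cdot\mid C_1)$ be the ground-truth and the model-predicted constrained distributions of the first token (defined in the context). Then, asymptotically for large $k$, $$\mathrm{KL}\left[\Pr(\cdot\mid C)\,\|\,\Pr(\cdot\mid C_1)\right]\ \gtrsim\ \frac{0.05}{k^{s}},$$ that is, there is a deterministic sequence $\varepsilon_k\to 0$ such that, with probability (over the random choice of $\mathcal{D}^c$) tending to $1$ as $k\to\infty$, $\mathrm{KL}\left[\Pr(\cdot\mid C)\,\|\,\Pr(\cdot\mid C_1)\right]\ge (1-\varepsilon_k)\,\frac{0.05}{k^{s}}$. In particular, when $s=0$ the lower bound is the constant $0.05$.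
   Context: $[k]=\{1,\dots,k\}$. Elements $d=(d_1,\dots,d_m)\in[k]^m$ are called documents, and $d_1$ is the first token. Let $\boldsymbol{d}$ be a random document with law $\Pr(\cdot)$, independent of the random set $\mathcal{D}^c$. Given a nonempty $\mathcal{D}^c$, a token $t\in[k]$ is called valid if some document in $\mathcal{D}^c$ has first token $t$. The ground-truth constrained first-token distribution is the law of $\boldsymbol d_1$ conditioned on $C=\{\boldsymbol{d}\in\mathcal{D}^c\}$: $$\Pr(t\mid C)\ \propto\ \sum_{d\in\mathcal{D}^c,\ d_1=t}\Pr(d),\qquad t\in[k].$$ The model-predicted distribution is the law of $\boldsymbol d_1$ conditioned on $C_1=\{\boldsymbol{d}_1\text{ is valid}\}$: $$\Pr(t\mid C_1)\ \propto\ \mathbb{I}[t\text{ is valid}]\sum_{d\in\mathcal{D},\ d_1=t}\Pr(d),\qquad t\in[k].$$ (For uniform $\Pr$, the first is proportional to the number of sampled documents with first token $t$, and the second is uniform over the valid tokens.) The Kullback–Leibler divergence is $\mathrm{KL}[P\|Q]=\sum_t P(t)\ln\frac{P(t)}{Q(t)}$ with natural logarithm and $0\ln 0=0$. The event $\mathcal{D}^c=\emptyset$, whose probability tends to $0$, may be ignored. *)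

(* Defs.v *)
From mathcomp Require Import all_boot all_order all_algebra.
From mathcomp Require Import all_classical all_reals all_analysis.
Set Implicit Arguments.
Unset Strict Implicit.
Unset Printing Implicit Defensive.
Import Order.TTheory GRing.Theory Num.Theory.
Local Open Scope ring_scope.

(* Law of the random subset of T containing each x : T independently with
   probability p: independence is the product over x of the inclusion or
   exclusion probabilities. *)
Definition subset_law (R : realType) (T : finType) (p : R) (A : {set T}) : R :=
  \prod_(x : T) (if x \in A then p else 1 - p).

Definition subset_prob (R : realType) (T : finType) (p : R)
    (E : pred {set T}) : R :=
  \sum_(A : {set T} | E A) subset_law p A.

Lemma subset_prob_total (R : realType) (T : finType) (p : R) :
  subset_prob p (fun _ : {set T} => true) = 1.
Proof.
rewrite /subset_prob /subset_law.
have H := @bigA_distr R 0 1 *%R +%R T (fun=> p) (fun=> 1 - p).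
rewrite [RHS](_ : 1 = \prod_(x : T) (p + (1 - p))); last first.
  by rewrite big1 // => x _; rewrite addrC subrK.
by rewrite H; apply: eq_bigl.
Qed.

Notation doc m k := (m.-tuple 'I_k).

Definition first_token (m k : nat) (hm : (0 < m)%N) (d : doc m k) : 'I_k :=
  tnth d (Ordinal hm).

Definition uniform_law (R : realType) (m k : nat) (d : doc m k) : R :=
  (#|{: doc m k}|%:R)^-1.

Definition valid (m k : nat) (hm : (0 < m)%N) (Dc : {set doc m k})
    (t : 'I_k) : bool :=
  [exists d in Dc, first_token hm d == t].

(* Law of the first token of a document with law Pr, given the event E; it is
   a probability distribution as soon as E has nonzero Pr-probability, and
   identically 0 otherwise. *)
Definition cond_first_token (R : realType) (m k : nat) (hm : (0 < m)%N)
    (Pr : doc m k -> R) (E : {set doc m k}) (t : 'I_k) : R :=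
  (\sum_(d in E | first_token hm d == t) Pr d) / (\sum_(d in E) Pr d).

Definition ground_truth (R : realType) (m k : nat) (hm : (0 < m)%N)
    (Pr : doc m k -> R) (Dc : {set doc m k}) : 'I_k -> R :=
  cond_first_token hm Pr Dc.

Definition model_predicted (R : realType) (m k : nat) (hm : (0 < m)%N)
    (Pr : doc m k -> R) (Dc : {set doc m k}) : 'I_k -> R :=
  cond_first_token hm Pr [set d | valid hm Dc (first_token hm d)].

(* Terms with P t = 0 vanish since ln is total. The formula is the usual
   divergence only when Q t = 0 implies P t = 0; this always holds for
   the pair (ground_truth, model_predicted) with Pr nonnegative. *)
Definition KL (R : realType) (T : finType) (P Q : T -> R) : R :=
  \sum_(t : T) P t * ln (P t / Q t).

(* Main.v *)
Require Import Defs.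
From mathcomp Require Import all_boot all_order all_algebra.
From mathcomp Require Import all_classical all_reals all_analysis.
From mathcomp Require Import ring lra.
Import Order.TTheory GRing.Theory Num.Theory.
Import numFieldNormedType.Exports.
Local Open Scope classical_set_scope.
Local Open Scope ring_scope.

(** The numbers [n_t] of sampled documents with first token [t] are independent
    binomial variables of mean [k ^ s]. With [N] their sum, [V] the number of
    valid tokens and any [a > 0],
      [N * KL = \sum_(t valid) (n_t ln (n_t / a) - n_t + a)
                + (N ln (a V / N) + N - a V)],
    where every summand of the first sum is nonnegative and the second part is
    at least [- (a V - N) ^ 2 / (a V)]. For [s = 0] take [a = 2] and keep only
    the tokens with [n_t = 1], each contributing [1 - ln 2]; for [s > 0] take
    [a = k ^ s], so that the second part is negligible and the first is bounded
    below through [\sum_t |n_t - k ^ s|], whose mean is controlled by second and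
    fourth moments. Chebyshev's inequality concentrates all these sums. Both
    limiting constants exceed [0.05], hence [eps = 0] works. *)

(** * Expectation over the random subset: linearity, Markov's inequality, independence *)

Definition expect {R : realType} {T : finType} (p : R) (F : {set T} -> R) : R :=
  \sum_(A : {set T}) subset_law p A * F A.

Lemma eq_expect {R : realType} {T : finType} (p : R) (F G : {set T} -> R) :
  F =1 G -> expect p F = expect p G.
Proof. by move=> FG; apply: eq_bigr => A _; rewrite FG. Qed.

Lemma expect_cst {R : realType} {T : finType} (p c : R) :
  expect p (fun _ : {set T} => c) = c.
Proof.
by rewrite /expect -mulr_suml; have := @subset_prob_total R T p;
  rewrite /subset_prob => ->; rewrite mul1r.
Qed.

Lemma expectD {R : realType} {T : finType} (p : R) (F G : {set T} -> R) :
  expect p (fun A => F A + G A) = expect p F + expect p G.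
Proof. by rewrite /expect -big_split; apply: eq_bigr => A _; rewrite mulrDr. Qed.

Lemma expectZ {R : realType} {T : finType} (p c : R) (F : {set T} -> R) :
  expect p (fun A => c * F A) = c * expect p F.
Proof. by rewrite /expect mulr_sumr; apply: eq_bigr => A _; rewrite mulrCA. Qed.

Lemma expect_sum {R : realType} {T I : finType} (p : R) (P : pred I)
    (F : I -> {set T} -> R) :
  expect p (fun A => \sum_(i | P i) F i A) = \sum_(i | P i) expect p (F i).
Proof.
by rewrite /expect exchange_big; apply: eq_bigr => A _; rewrite mulr_sumr.
Qed.

Lemma subset_law_ge0 {R : realType} {T : finType} (p : R) (A : {set T}) :
  0 <= p <= 1 -> 0 <= subset_law p A.
Proof.
move=> /andP[p0 p1]; apply: prodr_ge0 => x _.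
by case: ifP => // _; rewrite subr_ge0.
Qed.

Lemma subset_prob_le1 {R : realType} {T : finType} (p : R) (E : pred {set T}) :
  0 <= p <= 1 -> subset_prob p E <= 1.
Proof.
move=> p01; rewrite -(@subset_prob_total R T p) /subset_prob.
rewrite [leRHS](bigID E) /= lerDl; apply: sumr_ge0 => A _.
exact: subset_law_ge0.
Qed.

(** Markov's inequality: [Z] is nonnegative and at least [1] wherever [E] fails, so [1] is at most
    the indicator of [E] plus [Z], pointwise. *)
Lemma subset_prob_ge {R : realType} {T : finType} (p : R) (E : pred {set T})
    (Z : {set T} -> R) :
  0 <= p <= 1 -> (forall A, 0 <= Z A) -> (forall A, Z A < 1 -> E A) ->
  1 - expect p Z <= subset_prob p E.
Proof.
move=> p01 Z0 ZE; rewrite -[X in X - _](@expect_cst R T p 1).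
rewrite lerBlDr /subset_prob /expect [X in _ <= X + _]big_mkcond -big_split /=.
apply: ler_sum => A _; have law0 := subset_law_ge0 p A p01.
case: ifPn => [_|]; first by rewrite mulr1 lerDl mulr_ge0.
by rewrite add0r => /negP EA; rewrite ler_wpM2l // leNgt; apply/negP => /ZE.
Qed.

(* The product of expectations is a sum over pairs (A, B); exchanging the
   parts of A and B outside S preserves the product law and turns
   F A * G B into F A * G A. *)
Lemma expectM {R : realType} {T : finType} (p : R) (S : {set T})
    (F G : {set T} -> R) :
  (forall A, F A = F (A :&: S)) -> (forall A, G A = G (A :\: S)) ->
  expect p (fun A => F A * G A) = expect p F * expect p G.
Proof.
move=> FS GS.
pose mix (u : {set T} * {set T}) :=
  ((u.1 :&: S) :|: (u.2 :\: S), (u.2 :&: S) :|: (u.1 :\: S)).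
have mixK : involutive mix.
  move=> [A B]; congr pair; apply/setP => x; rewrite !inE /=;
  by case: (x \in A); case: (x \in B); case: (x \in S).
rewrite -[LHS]mulr1 -(@expect_cst R T p 1) /expect !big_distrlr /= !pair_big /=.
rewrite [RHS](reindex_inj (inv_inj mixK)) /=; apply: eq_bigr => -[A B] _ /=.
rewrite mulr1 mulrAC [RHS]mulrACA; congr (_ * _).
  rewrite /subset_law -!big_split; apply: eq_bigr => x _; rewrite !inE /=.
  by case: (x \in A); case: (x \in B); case: (x \in S) => //=; rewrite mulrC.
rewrite (FS A) (GS A) [in RHS]FS [in RHS]GS; congr (F _ * G _);
  by apply/setP => x; rewrite !inE /=; case: (x \in A); case: (x \in B); case: (x \in S).
Qed.

(** * Reduction of counts to binomial variables, and binomial moments *)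

Lemma expect_mem {R : realType} {T : finType} (p : R) (x : T) :
  expect p (fun A : {set T} => (x \in A)%:R) = p.
Proof.
(* The exclusion weight of [x] is set to [0], so that expanding the product keeps only the sets
   containing [x]. *)
have H := @bigA_distr R 0 1 *%R +%R T (fun=> p) (fun y => (1 - p) * (y != x)%:R).
transitivity (\prod_(y : T) (p + (1 - p) * (y != x)%:R)).
  rewrite H; apply: eq_bigr => A _; rewrite /subset_law.
  have [xA|xA] := boolP (x \in A).
    rewrite mulr1; apply: eq_bigr => y _; case: ifPn => // yA.
    by rewrite (_ : y != x) ?mulr1 //; apply: contraNneq yA => ->.
  by rewrite mulr0 (bigD1 x) //= (negPf xA) eqxx mulr0 mul0r.
rewrite (bigD1 x) //= eqxx mulr0 addr0 big1 ?mulr1 // => y ->.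
by rewrite mulr1 addrC subrK.
Qed.

(* Expectation of [f X] for [X] binomial with parameters [n] and [p]. *)
Fixpoint expect_bin {R : realType} (p : R) (n : nat) (f : nat -> R) : R :=
  if n is n'.+1 then p * expect_bin p n' (f \o succn) + (1 - p) * expect_bin p n' f
  else f 0%N.

(** Induction on the size of [S]: one element [x] is split off, and its membership is independent of
    the trace of [A] on [S :\ x]. This matches the recursion of [expect_bin]. *)
Lemma expect_card {R : realType} {T : finType} (p : R) (S : {set T})
    (f : nat -> R) :
  expect p (fun A => f #|A :&: S|) = expect_bin p #|S| f.
Proof.
elim: {S}#|S| {-2}S (erefl #|S|) f => [|n IHn] S Sn f.
  rewrite -[RHS](@expect_cst R T p); apply: eq_expect => A.
  by rewrite (cards0_eq Sn) finset.setI0 cards0.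
have /card_gt0P[x xS] : (0 < #|S|)%N by rewrite Sn.
have S'n : #|S :\ x| = n by move: Sn; rewrite (cardsD1 x) xS => -[].
have IH := IHn _ S'n; rewrite S'n in IH; rewrite Sn /= -(IH f) -(IH (f \o succn)).
transitivity (expect p (fun A : {set T} => (x \in A)%:R * f #|A :&: (S :\ x)|.+1
   + (1 - (x \in A)%:R) * f #|A :&: (S :\ x)|)).
  apply: eq_expect => A; rewrite (cardsD1 x) inE xS andbT.
  rewrite (_ : (A :&: S) :\ x = A :&: (S :\ x)); last first.
    by apply/setP => y; rewrite !inE andbCA.
  by case: (x \in A); rewrite ?subrr ?subr0 ?mul1r ?mul0r ?addr0 ?add0r.
have away A : (A :\: [set x]%SET) :&: (S :\ x) = A :&: (S :\ x).
  by apply/setP => y; rewrite !inE; case: (y == x); rewrite ?andbF.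
have near A : (x \in A :&: [set x]%SET) = (x \in A) by rewrite !inE eqxx andbT.
rewrite expectD; congr (_ + _).
  by rewrite (@expectM _ _ _ [set x]%SET) ?expect_mem // => A; rewrite ?near ?away.
rewrite (@expectM _ _ _ [set x]%SET) => [|A|A]; rewrite ?near ?away //.
congr (_ * _); rewrite expectD expect_cst -[X in _ - X](expect_mem p x).
rewrite -mulN1r -expectZ; congr (_ + _).
by apply: eq_expect => A; rewrite mulN1r.
Qed.

Lemma eq_expect_bin {R : realType} (p : R) n (f g : nat -> R) :
  f =1 g -> expect_bin p n f = expect_bin p n g.
Proof.
by elim: n f g => //= n IHn f g fg; rewrite (IHn _ g fg) (IHn _ (g \o succn)) // => j /=.
Qed.

Lemma expect_bin_cst {R : realType} (p : R) n (c : R) : expect_bin p n (fun=> c) = c.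
Proof. by elim: n => //= n IHn; rewrite (@eq_expect_bin _ _ _ _ (fun=> c)) // IHn; ring. Qed.

Lemma expect_binD {R : realType} (p : R) n (f g : nat -> R) :
  expect_bin p n (fun j => f j + g j) = expect_bin p n f + expect_bin p n g.
Proof.
elim: n f g => //= n IHn f g; rewrite IHn.
by rewrite (IHn (f \o succn) (g \o succn)); ring.
Qed.

Lemma expect_binZ {R : realType} (p : R) n (c : R) (f : nat -> R) :
  expect_bin p n (fun j => c * f j) = c * expect_bin p n f.
Proof.
elim: n f => //= n IHn f; rewrite IHn.
by rewrite (IHn (f \o succn)); ring.
Qed.

Lemma ler_expect_bin {R : realType} (p : R) n (f g : nat -> R) :
  0 <= p <= 1 -> (forall j, f j <= g j) -> expect_bin p n f <= expect_bin p n g.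
Proof.
move=> /andP[p0 p1]; elim: n f g => //= n IHn f g fg.
by apply: lerD; apply: ler_wpM2l; rewrite ?subr_ge0 // IHn // => j /=.
Qed.

Lemma expect_bin_eq0 {R : realType} (p : R) n :
  expect_bin p n (fun j => (j == 0%N)%:R) = (1 - p) ^+ n.
Proof.
elim: n => [|n IHn] /=; first by rewrite expr0.
by rewrite IHn (@eq_expect_bin _ _ _ _ (fun=> 0)) // expect_bin_cst mulr0 add0r exprS.
Qed.

Lemma expect_bin_eq1 {R : realType} (p : R) n :
  expect_bin p n (fun j => (j == 1%N)%:R) = n%:R * p * (1 - p) ^+ n.-1.
Proof.
elim: n => [|n IHn] /=; first by rewrite !mul0r.
rewrite IHn (@eq_expect_bin _ _ _ _ (fun j => (j == 0%N)%:R)) // expect_bin_eq0.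
case: n {IHn} => [|n] /=; first by rewrite !expr0; ring.
by rewrite [(1-p) ^+ n.+1]exprS -[n.+2]addn1 natrD; ring.
Qed.

(** One more trial shifts the centered variable by [1 - p] with probability [p] and by [- p] with
    probability [1 - p]. The third moment enters the fourth linearly in the shift, so its two
    contributions cancel and it never has to be computed. *)
Lemma expect_bin_centered {R : realType} (p : R) n :
  [/\ expect_bin p n (fun j => j%:R - n%:R * p) = 0,
      expect_bin p n (fun j => (j%:R - n%:R * p) ^+ 2) = n%:R * p * (1 - p) &
      expect_bin p n (fun j => (j%:R - n%:R * p) ^+ 4) =
        n%:R * p * (1 - p) * (1 - 3 * p * (1 - p)) +
        3 * n%:R * (n%:R - 1) * (p * (1 - p)) ^+ 2].
Proof.
elim: n => [|n [IH1 IH2 IH4]] /=; first by split; ring.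
set X := fun j : nat => j%:R - n%:R * p in IH1.
have E1 (c : R) : expect_bin p n (fun j => X j + c) = c.
  by rewrite expect_binD IH1 expect_bin_cst add0r.
have E2 (c : R) : expect_bin p n (fun j => (X j + c) ^+ 2) = n%:R * p * (1 - p) + c ^+ 2.
  rewrite (@eq_expect_bin _ _ _ _ (fun j => X j ^+ 2 + (2 * c * X j + c ^+ 2))).
    by rewrite !expect_binD expect_binZ IH1 IH2 expect_bin_cst mulr0 add0r.
  by move=> j; ring.
have E4 (c : R) : expect_bin p n (fun j => (X j + c) ^+ 4) =
    expect_bin p n (fun j => X j ^+ 4) + 4 * c * expect_bin p n (fun j => X j ^+ 3)
    + 6 * c ^+ 2 * (n%:R * p * (1 - p)) + c ^+ 4.
  rewrite (@eq_expect_bin _ _ _ _ (fun j => X j ^+ 4 + (4 * c * X j ^+ 3 +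
     (6 * c ^+ 2 * X j ^+ 2 + (4 * c ^+ 3 * X j + c ^+ 4))))).
    by rewrite !expect_binD !expect_binZ IH1 IH2 expect_bin_cst; ring.
  by move=> j; ring.
have shift1 j : (j.+1)%:R - n.+1%:R * p = X j + (1 - p).
  by rewrite /X -[j.+1]addn1 -[n.+1]addn1 !natrD; ring.
have shift0 j : j%:R - n.+1%:R * p = X j + (- p).
  by rewrite /X -[n.+1]addn1 !natrD; ring.
split.
- rewrite (@eq_expect_bin _ _ _ _ _ shift1) (@eq_expect_bin _ _ _ _ _ shift0).
  by rewrite !E1; ring.
- rewrite (@eq_expect_bin _ _ _ _ (fun j => (X j + (1 - p)) ^+ 2)) => [|j /=]; last by rewrite shift1.
  rewrite (@eq_expect_bin _ _ _ (fun j => (j%:R - _) ^+ 2) (fun j => (X j + (- p)) ^+ 2)) => [|j]; last by rewrite shift0.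
  by rewrite !E2 -[n.+1]addn1 natrD; ring.
- rewrite (@eq_expect_bin _ _ _ _ (fun j => (X j + (1 - p)) ^+ 4)) => [|j /=]; last by rewrite shift1.
  rewrite (@eq_expect_bin _ _ _ (fun j => (j%:R - _) ^+ 4) (fun j => (X j + (- p)) ^+ 4)) => [|j]; last by rewrite shift0.
  by rewrite !E4 IH4 -[n.+1]addn1 natrD; ring.
Qed.

(** * Mean and variance of sums over the blocks of a partition *)

Definition block {T I : finType} (g : T -> I) (i : I) : {set T} :=
  [set x | g x == i]%SET.

Definition block_count {T I : finType} (g : T -> I) (A : {set T}) (i : I) : nat :=
  #|A :&: block g i|.

Lemma expect_block_sum {R : realType} {T I : finType} (p : R) (g : T -> I)
    (n : nat) (f : nat -> R) :
  (forall i, #|block g i| = n) ->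
  expect p (fun A => \sum_i f (block_count g A i)) = #|I|%:R * expect_bin p n f.
Proof.
move=> gn; rewrite expect_sum (eq_bigr (fun=> expect_bin p n f)) => [|i _].
  by rewrite sumr_const mulr_natl.
by rewrite -(gn i) expect_card.
Qed.

(** Counts in distinct blocks are independent, so after centering [f] into [h] the cross terms of
    the squared sum vanish and only the variances remain. *)
Lemma expect_block_sum_sqr {R : realType} {T I : finType} (p : R) (g : T -> I)
    (n : nat) (f : nat -> R) :
  (forall i, #|block g i| = n) ->
  expect p (fun A => (\sum_i f (block_count g A i) - #|I|%:R * expect_bin p n f) ^+ 2)
    = #|I|%:R * (expect_bin p n (fun j => f j ^+ 2) - expect_bin p n f ^+ 2).
Proof.
move=> gn; pose h j := f j - expect_bin p n f.
have h0 : expect_bin p n h = 0 by rewrite expect_binD expect_bin_cst subrr.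
have h2 : expect_bin p n (fun j => h j ^+ 2) =
    expect_bin p n (fun j => f j ^+ 2) - expect_bin p n f ^+ 2.
  rewrite (@eq_expect_bin _ _ _ _ (fun j => f j ^+ 2 + (- 2 * expect_bin p n f * f j +
     expect_bin p n f ^+ 2))); last by move=> j; rewrite /h; ring.
  by rewrite !expect_binD expect_binZ expect_bin_cst; ring.
transitivity (expect p (fun A => \sum_i \sum_j
    h (block_count g A i) * h (block_count g A j))).
  apply: eq_expect => A; rewrite -big_distrlr /= -expr2; congr (_ ^+ 2).
  by rewrite sumrB sumr_const mulr_natl.
rewrite expect_sum (eq_bigr (fun=> expect_bin p n (fun j => h j ^+ 2))) => [|i _].
  by rewrite sumr_const mulr_natl h2.
rewrite expect_sum (bigD1 i) //= [X in _ + X]big1 => [|j ji].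
  rewrite addr0 -(gn i) -(@expect_card _ _ _ _ (fun j => h j ^+ 2)).
  by apply: eq_expect.
rewrite (@expectM _ _ _ (block g i)) => [|A|A].
- by rewrite expect_card gn h0 mul0r.
- by rewrite /block_count -finset.setIA finset.setIid.
- congr (h _); rewrite /block_count; apply: eq_card => x; rewrite !inE.
  by case: eqP => [->|]; rewrite ?andbF // (negPf ji) andbT.
Qed.

(** * Lower bound on the divergence of a family of counts *)

Lemma ln_ge_1Binv {R : realType} (x : R) : 0 < x -> 1 - x^-1 <= ln x.
Proof.
move=> x0; have xV : 0 < x^-1 by rewrite invr_gt0.
have := @le_ln1Dx R (x^-1 - 1); rewrite (_ : 1 + _ = x^-1); last by ring.
by rewrite lnV ?posrE // => h; have := h ltac:(lra); lra.
Qed.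

(* With [y = a * V / N], this is Jensen's inequality made quantitative by [G]:
   the loss [ln y + 1 - y] is at least [- (y - 1) ^+ 2 / y]. *)
Lemma KL_counts_ge {R : realType} {I : finType} (c : I -> nat) (a : R)
    (G : nat -> R) (N := \sum_i (c i)%:R) (V := \sum_i (0 < c i)%N%:R) :
  0 < a -> 0 < N ->
  (forall j, (0 < j)%N -> G j <= j%:R * ln (j%:R / a) - j%:R + a) ->
  \sum_(i | (0 < c i)%N) G (c i) - (a * V - N) ^+ 2 / (a * V) <=
  N * KL (fun i => (c i)%:R / N) (fun i => (0 < c i)%N%:R / V).
Proof.
move=> a0 N0 HG.
have V0 : 0 < V.
  rewrite lt_def sumr_ge0 ?andbT => [|i _]; last exact: ler0n.
  apply: contraTneq N0; move/psumr_eq0P => V0; rewrite -leNgt.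
  rewrite /N big1 // => i _; have := V0 (fun _ _ => ler0n _ _) i isT.
  by case: (c i) => // n /eqP; rewrite oner_eq0.
have VE : V = \sum_(i | (0 < c i)%N) 1.
  by rewrite /V [RHS]big_mkcond; apply: eq_bigr => i _; case: (0 < c i)%N.
have NE : N = \sum_(i | (0 < c i)%N) (c i)%:R.
  rewrite /N [RHS]big_mkcond; apply: eq_bigr => i _.
  by case: (c i).
have aVN : 0 < a * V / N by rewrite divr_gt0 ?mulr_gt0.
have -> : N * KL (fun i => (c i)%:R / N) (fun i => (0 < c i)%N%:R / V) =
    \sum_(i | (0 < c i)%N) ((c i)%:R * ln ((c i)%:R / a) + (c i)%:R * ln (a * V / N)).
  rewrite /KL mulr_sumr [RHS]big_mkcond; apply: eq_bigr => i _.
  case: posnP => [->|ci]; first by rewrite !mul0r mulr0.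
  rewrite -mulrDr -lnM ?posrE // ?divr_gt0 ?ltr0n // [N * _]mulrA.
  rewrite (_ : N * (_ / N) = (c i)%:R); last by field; rewrite gt_eqF.
  congr (_ * ln _); rewrite [_ true]/= mulr1n; field.
  by rewrite !gt_eqF.
(* The added terms sum to [(N - a V) + (N - N ^ 2 / (a V))], which is exactly
   [- (a V - N) ^ 2 / (a V)]. *)
apply: (@le_trans _ _ (\sum_(i | (0 < c i)%N) (G (c i) + ((c i)%:R - a) +
    (c i)%:R * (1 - (a * V / N)^-1)))).
  rewrite !big_split /= sumrN -mulr_suml -NE.
  rewrite (_ : \sum_(i | (0 < c i)%N) a = a * V); last first.
    by rewrite VE mulr_sumr mulr1.
  rewrite -!addrA lerD2l le_eqVlt; apply/orP; left; apply/eqP; field.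
  by rewrite !gt_eqF.
apply: ler_sum => i ci; apply: lerD; first by have := HG _ ci; lra.
by rewrite ler_wpM2l // ln_ge_1Binv.
Qed.

(** * The two first-token distributions in terms of counts *)

(** Prepending [t] is a bijection from the tuples of length [m - 1] onto the block of [t]. *)
Lemma card_first_token (m k : nat) (hm : (0 < m)%N) (t : 'I_k) :
  #|block (@first_token m k hm) t| = (k ^ m.-1)%N.
Proof.
case: m hm => // m hm /=.
rewrite -[in RHS](card_ord k) -(@card_tuple m) -cardsT.
rewrite -(@card_imset _ _ (fun d : m.-tuple 'I_k => [tuple of t :: d])); last first.
  by move=> d d' /(congr1 val) [] /val_inj.
apply: eq_card => d; rewrite inE.
have -> : first_token hm d = thead d by congr tnth; apply: val_inj.
apply/eqP/imsetP => [dt|[d' _ ->]]; last by rewrite theadE.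
by exists [tuple of behead d]; rewrite ?inE // [LHS]tuple_eta dt.
Qed.

Lemma block_count_gt0 (m k : nat) (hm : (0 < m)%N) (Dc : {set doc m k})
    (t : 'I_k) : (0 < block_count (@first_token m k hm) Dc t)%N = valid hm Dc t.
Proof.
apply/card_gt0P/existsP => [[d]|[d]] => [|dP]; last by exists d; rewrite !inE.
by rewrite !inE => dP; exists d.
Qed.

Lemma sum_uniform_block {R : realType} (m k : nat) (hm : (0 < m)%N)
    (E : {set doc m k}) (t : 'I_k) :
  \sum_(d in E | first_token hm d == t) uniform_law R d =
  (block_count (first_token hm) E t)%:R * (#|{: doc m k}|%:R)^-1.
Proof.
rewrite /uniform_law sumr_const -[LHS]mulr_natl; congr (_%:R * _).
by apply: eq_card => d; rewrite !inE.
Qed.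

Lemma sum_uniform {R : realType} (m k : nat) (hm : (0 < m)%N)
    (E : {set doc m k}) :
  \sum_(d in E) uniform_law R d =
  (\sum_t (block_count (first_token hm) E t)%:R) * (#|{: doc m k}|%:R)^-1.
Proof.
rewrite (partition_big (first_token hm) predT) //= mulr_suml.
by apply: eq_bigr => t _; rewrite sum_uniform_block.
Qed.

Lemma ground_truthE {R : realType} (m k : nat) (hm : (0 < m)%N)
    (Dc : {set doc m k}) (t : 'I_k) :
  ground_truth hm (@uniform_law R m k) Dc t =
  (block_count (first_token hm) Dc t)%:R /
    (\sum_i (block_count (first_token hm) Dc i)%:R).
Proof.
rewrite /ground_truth /cond_first_token sum_uniform_block (sum_uniform m k hm).
have k0 : (0 < k)%N by case: k t {Dc} => // -[].
by rewrite -mulf_div divff ?mulr1 // invr_eq0 pnatr_eq0 card_tuple card_ord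
  expn_eq0 negb_and -lt0n k0.
Qed.

(** The conditioning event is a union of whole blocks, one per valid token. They all have size
    [k ^ (m - 1)], which cancels in the quotient. *)
Lemma model_predictedE {R : realType} (m k : nat) (hm : (0 < m)%N)
    (Dc : {set doc m k}) (t : 'I_k) :
  model_predicted hm (@uniform_law R m k) Dc t =
  (0 < block_count (first_token hm) Dc t)%N%:R /
    (\sum_i (0 < block_count (first_token hm) Dc i)%N%:R).
Proof.
have k0 : (0 < k)%N by case: k t {Dc} => // -[].
have kn0 : (k ^ m.-1)%:R != 0 :> R.
  by rewrite pnatr_eq0 expn_eq0 negb_and -lt0n k0.
rewrite /model_predicted -/(ground_truth hm _ _ t) ground_truthE.
have E i : (block_count (first_token hm)
      [set d | valid hm Dc (first_token hm d)]%SET i)%:R =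
    (0 < block_count (first_token hm) Dc i)%N%:R * (k ^ m.-1)%:R :> R.
  rewrite block_count_gt0 -natrM -(card_first_token m k hm i) /block_count.
  case: (boolP (valid hm Dc i)) => vi.
    rewrite mul1n; congr (_%:R); apply: eq_card => d; rewrite !inE.
    by case: eqP => [->|]; rewrite ?vi ?andbF.
  rewrite mul0n; congr (_%:R); apply/eqP; rewrite cards_eq0; apply/eqP/setP => d.
  by rewrite !inE; case: eqP => [->|]; rewrite ?(negPf vi) ?andbF.
by rewrite E (eq_bigr _ (fun i _ => E i)) -mulr_suml -mulf_div divff ?mulr1.
Qed.

Lemma KL_first_token {R : realType} (m k : nat) (hm : (0 < m)%N)
    (Dc : {set doc m k}) (c := block_count (first_token hm) Dc) :
  KL (ground_truth hm (@uniform_law R m k) Dc)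
     (model_predicted hm (@uniform_law R m k) Dc) =
  KL (fun t => (c t)%:R / \sum_i (c i)%:R)
     (fun t => (0 < c t)%N%:R / \sum_i (0 < c i)%N%:R).
Proof. by apply: eq_bigr => t _; rewrite ground_truthE model_predictedE. Qed.

Lemma block_count_sum_gt0 {R : realType} {T I : finType} (g : T -> I)
    (A : {set T}) : 0 < \sum_i (block_count g A i)%:R :> R -> A != finset.set0.
Proof.
apply: contraTneq => ->; rewrite -leNgt big1 // => i _.
by rewrite /block_count finset.set0I cards0.
Qed.

(* From [x ln x - x + 1 >= (1 - sqrt x) ^+ 2] at [x = j / a] and
   [(sqrt a - sqrt j) ^+ 2 >= 2 e |j - a| - e ^+ 2 (sqrt a + sqrt j) ^+ 2]. *)
Lemma xlnx_ge_dist {R : realType} (a e : R) (j : nat) :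
  0 < a -> 0 <= e -> (0 < j)%N ->
  2 * e * `|j%:R - a| - 2 * e ^+ 2 * (j%:R + a) <=
  j%:R * ln (j%:R / a) - j%:R + a.
Proof.
move=> a0 e0 j0.
set x : R := Num.sqrt j%:R; set y := Num.sqrt a.
have x0 : 0 < x by rewrite sqrtr_gt0 ltr0n.
have y0 : 0 < y by rewrite sqrtr_gt0.
have -> : j%:R = x ^+ 2 by rewrite sqr_sqrtr // ler0n.
have -> : a = y ^+ 2 by rewrite sqr_sqrtr // ltW.
have lnxy : 2 * (1 - y / x) <= ln (x ^+ 2 / y ^+ 2).
  rewrite -expr_div_n lnXn ?divr_gt0 // mulr2n mulrDl !mul1r.
  have := @ln_ge_1Binv R (x / y) (divr_gt0 x0 y0); rewrite invf_div => h.
  exact: lerD.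
have := ler_wpM2l (sqr_ge0 x) lnxy.
have -> : x ^+ 2 * (2 * (1 - y / x)) = 2 * x ^+ 2 - 2 * x * y.
  by field; rewrite gt_eqF.
set L := _ * ln _ => hL.
rewrite subr_sqr normrM (gtr0_norm (addr_gt0 x0 y0)).
have h1 := sqr_ge0 (`|x - y| - e * (x + y)).
have h2 : `|x - y| ^+ 2 = (x - y) ^+ 2 by rewrite real_normK ?num_real.
(* As [(x + y) ^ 2 = 2 (x ^ 2 + y ^ 2) - (x - y) ^ 2], this term turns the [e ^ 2 (x + y) ^ 2] of
   [h1] into the [2 e ^ 2 (x ^ 2 + y ^ 2)] of the goal. *)
have h3 := mulr_ge0 (sqr_ge0 e) (sqr_ge0 (x - y)).
nra.
Qed.

(** * Numerical bounds on exponentials and on [ln 2] *)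

(** The bound [1 + x <= expR x] at [x = 1 / 128] and [x = - 1 / 128] is squared seven times,
    rounding down to a small fraction after each squaring. The upper bound on [expR (- 1)] comes
    from the lower bound on [expR 1]. *)
Lemma expRN1_bounds {R : realType} :
  (36 + 60 / 100) / 100 <= (expR (- 1) : R) <= 37 / 100.
Proof.
have E : expR 1 = expR (1 / 128) ^+ 2 ^+ 2 ^+ 2 ^+ 2 ^+ 2 ^+ 2 ^+ 2 :> R.
  by rewrite -!exprM -expRM_natl; congr expR; field.
have EN : expR (- 1) = expR (- 1 / 128) ^+ 2 ^+ 2 ^+ 2 ^+ 2 ^+ 2 ^+ 2 ^+ 2 :> R.
  by rewrite -!exprM -expRM_natl; congr expR; field.
have sq (x a b : R) : 0 <= a -> a <= x -> b <= a ^+ 2 -> b <= x ^+ 2.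
  by move=> a0 ax ba; rewrite (le_trans ba) // lerXn2r ?nnegrE // (le_trans a0).
have h1 : 1 + 1 / 128 <= expR (1 / 128) :> R by exact: expR_ge1Dx.
have h2 : 1 + (- 1 / 128) <= expR (- 1 / 128) :> R by exact: expR_ge1Dx.
have lo : (2703 / 1000) <= expR 1 :> R.
  rewrite E.
  refine (@sq _ (1053 / 640) _ _ _ _); [lra| |lra].
  refine (@sq _ (1883 / 1468) _ _ _ _); [lra| |lra].
  refine (@sq _ (1666 / 1471) _ _ _ _); [lra| |lra].
  refine (@sq _ (116 / 109) _ _ _ _); [lra| |lra].
  refine (@sq _ (979 / 949) _ _ _ _); [lra| |lra].
  refine (@sq _ (1360 / 1339) _ _ _ _); [lra| |lra].
  by refine (@sq _ (1 + 1 / 128) _ _ _ _); lra.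
have hi : ((36 + 60 / 100) / 100) <= expR (- 1) :> R.
  rewrite EN.
  refine (@sq _ (753 / 1244) _ _ _ _); [lra| |lra].
  refine (@sq _ (1097 / 1410) _ _ _ _); [lra| |lra].
  refine (@sq _ (172 / 195) _ _ _ _); [lra| |lra].
  refine (@sq _ (525 / 559) _ _ _ _); [lra| |lra].
  refine (@sq _ (251 / 259) _ _ _ _); [lra| |lra].
  refine (@sq _ (253 / 257) _ _ _ _); [lra| |lra].
  by refine (@sq _ (1 + (- 1 / 128)) _ _ _ _); lra.
rewrite hi /=; have := @expRxMexpNx_1 R 1; have := @expR_gt0 R 1.
by nra.
Qed.

(** Equivalent to [2 <= expR (7 / 10)], obtained by six rounded squarings from [1 + x <= expR x] at
    [x = (7 / 10) / 64]. *)
Lemma ln2_le {R : realType} : ln 2 <= (7 / 10) :> R.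
Proof.
rewrite -[leRHS]expRK ler_ln ?posrE ?expR_gt0 //.
have E : expR (7 / 10) = expR ((7 / 10) / 64) ^+ 2 ^+ 2 ^+ 2 ^+ 2 ^+ 2 ^+ 2 :> R.
  by rewrite -!exprM -expRM_natl; congr expR; field.
have sq (x a b : R) : 0 <= a -> a <= x -> b <= a ^+ 2 -> b <= x ^+ 2.
  by move=> a0 ax ba; rewrite (le_trans ba) // lerXn2r ?nnegrE // (le_trans a0).
have h1 : 1 + (7 / 10) / 64 <= expR ((7 / 10) / 64) :> R by exact: expR_ge1Dx.
rewrite E.
refine (@sq _ (956 / 675) _ _ _ _); [lra| |lra].
refine (@sq _ (144 / 121) _ _ _ _); [lra| |lra].
refine (@sq _ (12 / 11) _ _ _ _); [lra| |lra].
refine (@sq _ (869 / 832) _ _ _ _); [lra| |lra].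
refine (@sq _ (697 / 682) _ _ _ _); [lra| |lra].
by refine (@sq _ (1 + (7 / 10) / 64) _ _ _ _); lra.
Qed.

Lemma pow_1Binv_le {R : realType} (n : nat) : (0 < n)%N ->
  (1 - n%:R^-1) ^+ n <= expR (- 1) :> R.
Proof.
move=> n0.
have -> : expR (- 1) = expR (- n%:R^-1) ^+ n :> R.
  by rewrite -expRM_natl; congr expR; field; rewrite pnatr_eq0 -lt0n.
have h : n%:R^-1 <= 1 :> R by rewrite invf_le1 ?ltr0n // ler1n.
by rewrite lerXn2r ?nnegrE ?expR_ge0 ?subr_ge0 // expR_ge1Dx.
Qed.

(** The inverse of [1 - 1 / n] is [1 + 1 / (n - 1)], whose power [n - 1] is at most [expR 1]. The
    exponent [n.-1] is what makes this a lower bound. *)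
Lemma pow_1Binv_ge {R : realType} (n : nat) : (1 < n)%N ->
  expR (- 1) <= (1 - n%:R^-1) ^+ n.-1 :> R.
Proof.
case: n => [|[|n]] // _ /=.
have n1 : 0 < n.+1%:R :> R by rewrite ltr0n.
have -> : 1 - n.+2%:R^-1 = (1 + n.+1%:R^-1)^-1 :> R.
  by rewrite -[n.+2]addn1 natrD; field; rewrite !gt_eqF //; lra.
rewrite expRN exprVn lef_pV2 ?posrE ?expR_gt0 ?exprn_gt0 //.
have -> : expR 1 = expR n.+1%:R^-1 ^+ n.+1 :> R.
  by rewrite -expRM_natl; congr expR; field; rewrite gt_eqF.
by rewrite lerXn2r ?nnegrE ?expR_ge0 ?expR_ge1Dx // addr_ge0 // invr_ge0 ler0n.
Qed.

(** * Deterministic divergence bounds for typical counts *)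

Lemma ler_dist_sqr {R : realType} (x y : R) :
  0 <= y -> x ^+ 2 < y ^+ 2 -> - y <= x <= y.
Proof.
move=> y0 xy; rewrite -ler_norml -(@ler_pXn2r _ 2) ?nnegrE // .
by rewrite real_normK ?num_real // ltW.
Qed.

(* The constants are composed of small literals because numerals of [R] unfold
   to unary naturals. *)
Lemma KL_counts_sparse {R : realType} {I : finType} (c : I -> nat) (K : R)
    (N := \sum_i (c i)%:R) (V := \sum_i (0 < c i)%N%:R)
    (N1 := \sum_i (c i == 1%N)%:R) :
  0 < K -> ((99 + 80 / 100) / 100) * K <= N <= ((100 + 20 / 100) / 100) * K ->
  ((62 + 90 / 100) / 100) * K <= V <= ((63 + 45 / 100) / 100) * K ->
  ((36 + 50 / 100) / 100) * K <= N1 ->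
  5 / 100 <= KL (fun i => (c i)%:R / N) (fun i => (0 < c i)%N%:R / V).
Proof.
move=> K0 /andP[N_lo N_hi] /andP[V_lo V_hi] N1_lo.
have N0 : 0 < N by lra.
pose G j : R := (1 - ln 2) * (j == 1%N)%:R.
have HG (j : nat) : (0 < j)%N -> G j <= j%:R * ln (j%:R / 2) - j%:R + 2.
  move=> j0; rewrite /G; case: (eqVneq j 1%N) => [->|j1].
    by rewrite /= mulr1 mul1r div1r lnV ?posrE //; lra.
  (* At [e = 0] the distance bound is just the nonnegativity of [j ln (j / 2) - j + 2]. *)
  have := @xlnx_ge_dist R 2 0 j ltac:(lra) (lexx 0) j0.
  by rewrite !mulr0 !expr0n /= !mulr0 !mul0r subr0.
have := @KL_counts_ge R I c 2 G ltac:(lra) N0 HG; rewrite -/N -/V.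
set D := KL _ _.
have -> : \sum_(i | (0 < c i)%N) G (c i) = (1 - ln 2) * N1.
  rewrite /N1 mulr_sumr big_mkcond; apply: eq_bigr => i _; rewrite /G.
  by case: (c i); rewrite //= mulr0.
(* The windows give [0.271 ^ 2 / 1.258 < 0.0585] per unit of [K]. *)
have loss : (2 * V - N) ^+ 2 / (2 * V) <= ((5 + 85 / 100) / 100) * K.
  rewrite ler_pdivrMr; last lra.
  have : 0 <= 2 * V - N <= ((27 + 10 / 100) / 100) * K by apply/andP; split; lra.
  by move=> /andP[]; nra.
have gain : (3 / 10) * N1 <= (1 - ln 2) * N1.
  by apply: ler_wpM2r; [lra|have := @ln2_le R; lra].
(* Per unit of [K]: [0.3 * 0.365 - 0.0585 = 0.051], against [0.05 * 1.002 = 0.0501]. *)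
move=> h; have : 5 / 100 * N <= N * D by lra.
by rewrite mulrC ler_pM2l.
Qed.

(** Here [L ^ 2] plays the mean count, so [L] is the scale of its fluctuations. Deviations of order
    [L] at a typical token cost a constant per token, while [N] is of order [K * L ^ 2]; hence the
    factor [1 / L ^ 2]. *)
Lemma KL_counts_dense {R : realType} {I : finType} (c : I -> nat) (L : R)
    (K : R := #|I|%:R)
    (N := \sum_i (c i)%:R) (V := \sum_i (0 < c i)%N%:R) :
  10 <= L -> 0 < K ->
  - ((1 / 100) * K * L) <= N - K * L ^+ 2 <= (1 / 100) * K * L ->
  K - V <= (1 / 100) * K / L ->
  (54 / 100) * K * L <= \sum_i `|(c i)%:R - L ^+ 2| ->
  5 / 100 / L ^+ 2 <= KL (fun i => (c i)%:R / N) (fun i => (0 < c i)%N%:R / V).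
Proof.
move=> L10 K0 /andP[N_lo N_hi] V_lo D_lo.
have L0 : 0 < L by lra.
have L2 : 0 < L ^+ 2 by rewrite exprn_gt0.
have KL0 : 0 < K * L by rewrite mulr_gt0.
have KL10 : 10 * (K * L) <= K * L ^+ 2 by nra.
have N0 : 0 < N by lra.
(* Close to the maximizer [0.135 / L] of [2 e * 0.54 L - 4 e ^ 2 L ^ 2], the approximate gain per
   token. *)
pose e : R := 1 / (8 * L).
have e0 : 0 <= e by rewrite divr_ge0 // mulr_ge0 // ltW.
pose G j : R := 2 * e * `|j%:R - L ^+ 2| - 2 * e ^+ 2 * (j%:R + L ^+ 2).
have := @KL_counts_ge R I c (L ^+ 2) G L2 N0 (fun j => @xlnx_ge_dist R _ _ j L2 e0).
rewrite -/N -/V; set D := KL _ _.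
have VK : K - V = \sum_(i | (0 == c i)%N) 1.
  rewrite /K -sum1_card natr_sum -sumrB [RHS]big_mkcond; apply: eq_bigr => i _.
  by case: (c i) => [|j] /=; rewrite ?subr0 ?subrr.
have V_le : 0 <= K - V by rewrite VK sumr_ge0.
(* The sum over valid tokens is the full sum minus the empty tokens, each of which carries at most
   [2 e L ^ 2]. *)
have gain : 2 * e * ((54 / 100) * K * L - L ^+ 2 * (K - V)) -
    2 * e ^+ 2 * (N + L ^+ 2 * K) <= \sum_(i | (0 < c i)%N) G (c i).
  have -> : \sum_(i | (0 < c i)%N) G (c i) =
      \sum_i G (c i) - \sum_(i | (0 == c i)%N) G 0%N.
    rewrite [X in X - _](bigID (fun i => (0 < c i)%N)) /= -addrA.
    rewrite [X in _ + X](_ : _ = 0) ?addr0 //; apply/eqP; rewrite subr_eq0; apply/eqP.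
    by apply: eq_big => i; rewrite -eqn0Ngt 1?eq_sym // => /eqP ->.
  have -> : \sum_i G (c i) = 2 * e * \sum_i `|(c i)%:R - L ^+ 2| -
      2 * e ^+ 2 * (N + L ^+ 2 * K).
    rewrite /G sumrB -!mulr_sumr big_split /= sumr_const mulr_natr.
    by rewrite cardT -cardE.
  have G0 : \sum_(i | (0 == c i)%N) G 0%N <= 2 * e * (L ^+ 2 * (K - V)).
    rewrite VK !mulr_sumr; apply: ler_sum => i _; rewrite mulr1 /G !add0r.
    rewrite normrN (gtr0_norm L2) lerBlDr lerDl.
    by rewrite mulr_ge0 ?sqr_ge0 // mulr_ge0 ?sqr_ge0.
  have := ler_wpM2l (mulr_ge0 (ler0n R 2) e0) D_lo.
  by move: G0; lra.
have LKV : L ^+ 2 * (K - V) <= (1 / 100) * K * L.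
  rewrite (_ : (1 / 100) * K * L = L ^+ 2 * ((1 / 100) * K / L)); last by field; rewrite gt_eqF.
  by rewrite ler_pM2l.
have LKV0 : 0 <= L ^+ 2 * (K - V) by rewrite mulr_ge0 // ltW.
have gain1 : (13 / 100) * K <= 2 * e * ((54 / 100) * K * L - L ^+ 2 * (K - V)).
  rewrite (_ : 2 * e = 1 / (4 * L)); last by rewrite /e; field; rewrite gt_eqF.
  rewrite [leRHS]mulrAC mul1r ler_pdivlMr; last by lra.
  by lra.
have gain2 : 2 * e ^+ 2 * (N + L ^+ 2 * K) <= (63 / 1000) * K.
  rewrite (_ : 2 * e ^+ 2 = 1 / (32 * L ^+ 2)); last by rewrite /e; field; rewrite gt_eqF.
  by rewrite [leLHS]mulrAC mul1r ler_pdivrMr; lra.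
have loss : (L ^+ 2 * V - N) ^+ 2 / (L ^+ 2 * V) <= (1 / 1000) * K.
  rewrite ler_pdivrMr; last by lra.
  have : - ((2 / 100) * K * L) <= L ^+ 2 * V - N <= (2 / 100) * K * L by apply/andP; split; lra.
  have : (1 / 1000) * K * ((9 / 10) * K * L ^+ 2) <= (1 / 1000) * K * (L ^+ 2 * V).
    by apply: ler_wpM2l; lra.
  by move=> h /andP[h1 h2]; nra.
(* Per unit of [K], the gain minus both losses is [0.13 - 0.063 - 0.001 = 0.066]. *)
move=> h; have : N * (5 / 100 / L ^+ 2) <= N * D.
  suff : N * (5 / 100 / L ^+ 2) <= (6 / 100) * K by lra.
  by rewrite mulrA ler_pdivrMr //; lra.
by rewrite ler_pM2l.
Qed.

(** * Concentration of the counts around their means *)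

Lemma expect_block_sum_sqr_le {R : realType} {T I : finType} (p : R)
    (g : T -> I) (n : nat) (f : nat -> R) (M : R) :
  (forall i, #|block g i| = n) -> expect_bin p n (fun j => f j ^+ 2) <= M ->
  expect p (fun A => (\sum_i f (block_count g A i) - #|I|%:R * expect_bin p n f) ^+ 2)
    <= #|I|%:R * M.
Proof.
move=> gn fM; rewrite (expect_block_sum_sqr _ _ _ _ gn) ler_wpM2l //.
by rewrite (le_trans _ fM) // lerBlDr lerDl sqr_ge0.
Qed.

Lemma sum_block_centered {R : realType} {T I : finType} (p : R) (g : T -> I)
    (n : nat) (A : {set T}) :
  \sum_i ((block_count g A i)%:R - n%:R * p) -
    #|I|%:R * expect_bin p n (fun j => j%:R - n%:R * p) =
  \sum_i (block_count g A i)%:R - #|I|%:R * (n%:R * p).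
Proof.
have [-> _ _] := expect_bin_centered p n.
by rewrite mulr0 subr0 sumrB sumr_const [#|I|%:R * _]mulr_natl.
Qed.

(** Chebyshev's inequality for [N], [V] and the number of singleton tokens at once: each has
    variance at most [K], and [Z < 1] forces all three deviations within [K / 100 ^ 2]. *)
Lemma subset_prob_sparse {R : realType} {T I : finType} (p : R) (g : T -> I)
    (n : nat) :
  (forall i, #|block g i| = n) -> 100 ^+ 2 <= n%:R :> R -> n%:R * p = 1 ->
  (0 < #|I|)%N ->
  1 - 3 / (1 / 100 ^+ 2) ^+ 2 / #|I|%:R <=
  subset_prob p (fun A => (A != finset.set0) &&
    ((5 / 100 : R) <= KL
      (fun i => (block_count g A i)%:R / \sum_j (block_count g A j)%:R)
      (fun i => (0 < block_count g A i)%N%:R /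
                \sum_j (0 < block_count g A j)%N%:R))).
Proof.
move=> gn n_ge np I0; set K : R := #|I|%:R.
have K0 : 0 < K by rewrite ltr0n.
have n0 : 0 < n%:R :> R by lra.
have n1 : (1 < n)%N by rewrite -(ltr1n R); lra.
have pE : p = n%:R^-1 by rewrite -[LHS](mulKf (lt0r_neq0 n0)) np mulr1.
have p0 : 0 <= p by rewrite pE invr_ge0 ltW.
have pV : p <= 1 / 100 ^+ 2.
  by have := ler_wpM2l p0 n_ge; rewrite [p * _]mulrC [p * _]mulrC np; lra.
have p01 : 0 <= p <= 1 by rewrite p0 /=; lra.
(* The tolerance stays an opaque variable for [field]; its value is restored only for the final
   estimates. *)
have [t tE] : exists t : R, t = 1 / 100 ^+ 2 by eexists.
rewrite -tE.
have t0 : 0 < t by lra.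
pose X1 A := \sum_i ((block_count g A i)%:R - n%:R * p) -
    K * expect_bin p n (fun j => j%:R - n%:R * p).
pose X2 A := \sum_i (0 < block_count g A i)%N%:R -
    K * expect_bin p n (fun j => (0 < j)%N%:R).
pose X3 A := \sum_i (block_count g A i == 1%N)%:R -
    K * expect_bin p n (fun j => (j == 1%N)%:R).
pose d : R := (t * K) ^+ 2.
have d0 : 0 < d by rewrite exprn_gt0 // mulr_gt0.
pose Z A := d^-1 * (X1 A ^+ 2 + X2 A ^+ 2 + X3 A ^+ 2).
have bool_le (b : nat -> bool) : expect_bin p n (fun j => (b j)%:R ^+ 2) <= 1.
  rewrite -[leRHS](expect_bin_cst p n); apply: ler_expect_bin => // j.
  by case: (b j); rewrite ?expr1n ?expr0n.
have EZ : expect p Z <= 3 / t ^+ 2 / K.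
  rewrite expectZ !expectD mulrC ler_pdivrMr //.
  rewrite (_ : _ / K * d = K * 1 + K * 1 + K * 1); last first.
    by rewrite /d; field; rewrite !gt_eqF.
  rewrite !lerD // (@expect_block_sum_sqr_le _ _ _ _ _ _ _ _ gn) //.
  have [_ -> _] := expect_bin_centered p n; by rewrite np mul1r gerBl.
apply: le_trans (subset_prob_ge p _ Z p01 _ _); first by rewrite lerB.
  by move=> A; rewrite mulr_ge0 ?invr_ge0 ?(ltW d0) // !addr_ge0 ?sqr_ge0.
move=> A; rewrite /Z mulrC ltr_pdivrMr // mul1r => ZA.
have S1 := sqr_ge0 (X1 A); have S2 := sqr_ge0 (X2 A); have S3 := sqr_ge0 (X3 A).
have dev (x : R) : x ^+ 2 < d -> - (t * K) <= x <= t * K.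
  by apply: ler_dist_sqr; rewrite mulr_ge0 // ltW.
have /andP[N_lo N_hi] := dev (X1 A) ltac:(lra).
have /andP[V_lo V_hi] := dev (X2 A) ltac:(lra).
have /andP[N1_lo N1_hi] := dev (X3 A) ltac:(lra).
rewrite /X1 sum_block_centered np in N_lo N_hi.
have q_le : (1 - p) ^+ n <= expR (- 1).
  by rewrite pE pow_1Binv_le // ltnW.
have q_ge : expR (- 1) <= (1 - p) ^+ n.-1.
  by rewrite pE pow_1Binv_ge.
(* The bound with exponent [n.-1] costs a factor [1 - p] at exponent [n], harmless since
   [p <= 1 / 100 ^ 2]. *)
have q_ge' : (1 - p) * expR (- 1) <= (1 - p) ^+ n.
  have -> : n = n.-1.+1 by rewrite prednK // ltnW.
  by rewrite exprS ler_wpM2l // subr_ge0; case/andP: p01.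
rewrite /X2 (@eq_expect_bin _ _ _ _ (fun j => 1 + (- 1) * (j == 0%N)%:R)) in V_lo V_hi; last first.
  by case=> [|j] /=; rewrite ?mulr1 ?subrr ?mulr0 ?addr0.
rewrite expect_binD expect_binZ expect_bin_cst expect_bin_eq0 in V_lo V_hi.
rewrite /X3 expect_bin_eq1 np mul1r in N1_lo N1_hi.
have /andP[e_lo e_hi] := @expRN1_bounds R.
move: V_lo V_hi N1_lo; set q := (1 - p) ^+ n in q_le q_ge' *.
set q' := (1 - p) ^+ n.-1 in q_ge *; set e := expR _ in q_le q_ge q_ge' e_lo e_hi.
move=> V_lo V_hi N1_lo.
have tK : t * K = 1 / 100 ^+ 2 * K by rewrite tE.
rewrite tK in N_lo N_hi V_lo V_hi N1_lo.
have pe : p * e <= 1 / 100 ^+ 2 * (37 / 100) by apply: ler_pM => //; lra.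
have Kq1 : K * q <= K * (37 / 100) by rewrite ler_pM2l //; lra.
have Kq2 : K * ((36 + 58 / 100) / 100) <= K * q by rewrite ler_pM2l //; lra.
have Kq' : K * ((36 + 60 / 100) / 100) <= K * q' by rewrite ler_pM2l //; lra.
apply/andP; split.
  by apply: (@block_count_sum_gt0 R _ _ g); lra.
by apply: (@KL_counts_sparse _ _ _ K) => //; rewrite ?(andP, K0) //; try (apply/andP; split); lra.
Qed.

(** A quartic minorant of the absolute value reduces the claim to moments: variance about [L ^ 2]
    and fourth moment at most [L ^ 2 + 3 L ^ 4] give nearly [(3 / 4 - 3 / 16) L = 0.5625 L]. *)
Lemma expect_bin_dist_ge {R : realType} (p L : R) (n : nat) :
  0 <= p <= 1 / 100 -> 10 <= L -> n%:R * p = L ^+ 2 ->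
  55 / 100 * L <= expect_bin p n (fun j => `|j%:R - L ^+ 2|).
Proof.
move=> /andP[p0 p1] L10 np.
have L0 : 0 < L by lra.
have [_ E2 E4] := expect_bin_centered p n; rewrite np in E2 E4.
(* The quartic touches [|x|] at [|x| = 2 * L]: the difference is
   [w * (w - 2) ^+ 2 * (w + 4) * L / 16] at [|x| = w * L]. *)
have quartic (x : R) :
    3 / 4 / L * x ^+ 2 + (- (1 / 16 / L ^+ 3)) * x ^+ 4 <= `|x|.
  have -> : x ^+ 4 = (`|x| ^+ 2) ^+ 2 by rewrite real_normK ?num_real // -exprM.
  have -> : x ^+ 2 = `|x| ^+ 2 by rewrite real_normK ?num_real.
  have w0 := normr_ge0 x; move: `|x| w0 => w w0.
  rewrite -subr_ge0 (_ : _ - _ = w * ((w - 2 * L) ^+ 2 * (w + 4 * L)) / (16 * L ^+ 3)).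
    apply: divr_ge0; last by rewrite mulr_ge0 // exprn_ge0 // ltW.
    by rewrite mulr_ge0 // mulr_ge0 ?sqr_ge0 //; lra.
  by field; rewrite gt_eqF.
apply: le_trans (ler_expect_bin p n _ _ _ (fun j => quartic (j%:R - L ^+ 2))); last first.
  by rewrite p0; lra.
rewrite expect_binD !expect_binZ E2 E4.
have -> : 3 * n%:R * (n%:R - 1) * (p * (1 - p)) ^+ 2 =
    3 * (n%:R * p) * (n%:R * p - p) * (1 - p) ^+ 2 by ring.
rewrite np.
have M4 : L ^+ 2 * (1 - p) * (1 - 3 * p * (1 - p)) +
    3 * L ^+ 2 * (L ^+ 2 - p) * (1 - p) ^+ 2 <= L ^+ 2 * (1 + 3 * L ^+ 2).
  rewrite (_ : _ + _ = L ^+ 2 * ((1 - p) * (1 - 3 * p * (1 - p)) +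
    3 * ((L ^+ 2 - p) * (1 - p) ^+ 2))); last by ring.
  rewrite ler_wpM2l ?sqr_ge0 //.
  have L2 : 0 <= L ^+ 2 by rewrite sqr_ge0.
  have h1 : (1 - p) * (1 - 3 * p * (1 - p)) <= 1 by nra.
  have h2 : (L ^+ 2 - p) * (1 - p) ^+ 2 <= L ^+ 2 * 1.
    by apply: ler_pM; [nra|exact: sqr_ge0|lra|nra].
  by move: h1 h2; lra.
have c4 : 0 <= 1 / 16 / L ^+ 3 by rewrite divr_ge0 ?exprn_ge0 // ltW.
have := ler_wpM2l c4 M4.
have -> : 1 / 16 / L ^+ 3 * (L ^+ 2 * (1 + 3 * L ^+ 2)) =
   1 / 16 / L + 3 / 16 * L by field; rewrite gt_eqF.
have -> : 3 / 4 / L * (L ^+ 2 * (1 - p)) = 3 / 4 * (L - L * p).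
  by field; rewrite gt_eqF.
have Lp : L * p <= L * (1 / 100) by rewrite ler_pM2l.
have LV : 1 / 16 / L <= 1 / 100 by rewrite ler_pdivrMr //; lra.
by set Y := _ * (_ + _); rewrite mulNr -/Y; lra.
Qed.

(** Chebyshev's inequality for [N] and for the total distance to [L ^ 2] fails with probability at
    most [2 * 100 ^ 2 / K]; Markov's inequality for the number [X3] of empty tokens adds
    [100 / L]. *)
Lemma subset_prob_dense {R : realType} {T I : finType} (p L : R) (g : T -> I)
    (n : nat) :
  (forall i, #|block g i| = n) -> 0 <= p <= 1 / 100 -> 10 <= L ->
  n%:R * p = L ^+ 2 -> (0 < #|I|)%N ->
  1 - (2 * 100 ^+ 2 / #|I|%:R + 100 / L) <=
  subset_prob p (fun A => (A != finset.set0) &&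
    (5 / 100 / L ^+ 2 <= KL
      (fun i => (block_count g A i)%:R / \sum_j (block_count g A j)%:R)
      (fun i => (0 < block_count g A i)%N%:R /
                \sum_j (0 < block_count g A j)%N%:R))).
Proof.
move=> gn p_bd L10 np I0; set K : R := #|I|%:R.
have K0 : 0 < K by rewrite ltr0n.
have L0 : 0 < L by lra.
have L2 : 0 < L ^+ 2 by rewrite exprn_gt0.
have [_ var _] := expect_bin_centered p n; rewrite np in var.
have p01 : 0 <= p <= 1 by case/andP: p_bd => -> /=; lra.
have var_le : L ^+ 2 * (1 - p) <= L ^+ 2.
  by rewrite -[leRHS]mulr1 ler_pM2l //; case/andP: p01; lra.
pose X1 A := \sum_i ((block_count g A i)%:R - n%:R * p) -
    K * expect_bin p n (fun j => j%:R - n%:R * p).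
pose X2 A := \sum_i `|(block_count g A i)%:R - L ^+ 2| -
    K * expect_bin p n (fun j => `|j%:R - L ^+ 2|).
pose X3 A : R := \sum_i (block_count g A i == 0)%N%:R.
pose d := (1 / 100 * K * L) ^+ 2.
have d0 : 0 < d by rewrite exprn_gt0 // !mulr_gt0.
pose d' := 1 / 100 * K / L.
have d'0 : 0 < d' by rewrite divr_gt0 // mulr_gt0.
pose Z A := d^-1 * (X1 A ^+ 2 + X2 A ^+ 2) + d'^-1 * X3 A.
have EX3 : expect p X3 <= K / L ^+ 2.
  rewrite (expect_block_sum _ _ _ (fun j => (j == 0)%N%:R) gn) ler_wpM2l ?(ltW K0) //.
  (* The scaled square equals [1] at [j = 0], so it dominates the indicator of an empty token. *)
  apply: (@le_trans _ _ (expect_bin p n (fun j => (L ^+ 4)^-1 * (j%:R - L ^+ 2) ^+ 2))).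
    apply: ler_expect_bin => // -[|j] /=.
      by rewrite sub0r sqrrN -exprM mulVf ?gt_eqF ?exprn_gt0.
    by rewrite mulr_ge0 ?sqr_ge0 // invr_ge0 exprn_ge0 // ltW.
  rewrite expect_binZ var mulrC ler_pdivrMr ?exprn_gt0 //.
  by rewrite (_ : _ * L ^+ 4 = L ^+ 2) //; field; rewrite gt_eqF.
have EZ : expect p Z <= 2 * 100 ^+ 2 / K + 100 / L.
  rewrite expectD; apply: lerD; last first.
    rewrite expectZ mulrC ler_pdivrMr // (le_trans EX3) // le_eqVlt; apply/orP; left.
    by apply/eqP; rewrite /d'; field; rewrite !gt_eqF.
  rewrite expectZ expectD mulrC ler_pdivrMr //.
  rewrite (_ : _ / K * d = K * L ^+ 2 + K * L ^+ 2); last first.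
    by rewrite /d; field; rewrite gt_eqF.
  rewrite lerD // (@expect_block_sum_sqr_le _ _ _ _ _ _ _ _ gn) //.
    by rewrite np var.
  rewrite (@eq_expect_bin _ _ _ _ (fun j => (j%:R - L ^+ 2) ^+ 2)) ?var // => j.
  by rewrite real_normK ?num_real.
apply: le_trans (subset_prob_ge p _ Z p01 _ _); first by lra.
  move=> A; rewrite addr_ge0 // mulr_ge0 ?invr_ge0 ?(ltW d0) ?(ltW d'0) //.
    by rewrite addr_ge0 ?sqr_ge0.
  by rewrite sumr_ge0.
move=> A ZA.
have X30 : 0 <= X3 A by rewrite sumr_ge0.
have ZA3 : X3 A <= d'.
  rewrite -[leRHS]mulr1 -ler_pdivrMl // ltW // (le_lt_trans _ ZA) // lerDr.
  by rewrite mulr_ge0 ?invr_ge0 ?(ltW d0) // addr_ge0 ?sqr_ge0.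
have ZA12 : X1 A ^+ 2 + X2 A ^+ 2 < d.
  rewrite -[ltRHS]mulr1 -ltr_pdivrMl // (le_lt_trans _ ZA) // lerDl.
  by rewrite mulr_ge0 ?invr_ge0 ?(ltW d'0).
have S1 := sqr_ge0 (X1 A); have S2 := sqr_ge0 (X2 A).
have dev (x : R) : x ^+ 2 < d -> - (1 / 100 * K * L) <= x <= 1 / 100 * K * L.
  by apply: ler_dist_sqr; rewrite !mulr_ge0 // ltW.
have := dev (X1 A) ltac:(lra); rewrite /X1 sum_block_centered np => N_bd.
have /andP[D_lo _] := dev (X2 A) ltac:(lra).
have mean := ler_wpM2l (ltW K0) (expect_bin_dist_ge p L n p_bd L10 np).
have V_eq : K - \sum_i (0 < block_count g A i)%N%:R = X3 A.
  rewrite /K -sum1_card natr_sum -sumrB; apply: eq_bigr => i _.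
  by case: (block_count g A i) => [|j] /=; rewrite ?subr0 ?subrr.
apply/andP; split.
  apply: (@block_count_sum_gt0 R _ _ g).
  have : 10 * (K * L) <= K * L ^+ 2 by nra.
  by have := mulr_gt0 K0 L0; case/andP: N_bd; lra.
apply: KL_counts_dense => //; first by rewrite -/K V_eq.
by move: D_lo; rewrite /X2 -/K; lra.
Qed.

(** * Limits in [k] and the two regimes of [s] *)

Lemma cvgry_powR_nat {R : realType} (a : R) :
  0 < a -> (k%:R `^ a : R) @[k --> \oo] --> +oo.
Proof.
move=> a0; apply/cvgryPge => M.
have [k0 k0M] : exists k0 : nat, `|M| `^ a^-1 <= k0%:R.
  by exists (Num.truncn (`|M| `^ a^-1)).+1; rewrite ltW // truncnS_gt.
near=> k; apply: le_trans (ler_norm M) _.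
rewrite (_ : `|M| = (`|M| `^ a^-1) `^ a); last first.
  by rewrite -powRrM mulVf ?powRr1 // lt0r_neq0.
apply: ge0_ler_powR; rewrite ?nnegrE ?powR_ge0 ?(ltW a0) //.
apply: le_trans k0M _; rewrite ler_nat; near: k; exact: nbhs_infty_ge.
Unshelve. all: end_near. Qed.

Lemma cvg0_invr {R : realType} (c : R) (f : nat -> R) :
  f @ \oo --> +oo -> (c / f k) @[k --> \oo] --> (0 : R).
Proof.
move=> fy; rewrite -[X in _ --> X](mulr0 c); apply: cvgMr.
by apply/gtr0_cvgV0 => //; move/cvgryPgt : fy; apply.
Qed.

Theorem theoremB2 (R : realType) (m r : nat) (hm : (2 <= m)%N)
    (hr : r = (m - 1)%N) (s : R) (hs0 : 0 <= s) (hsr : s < r%:R) :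
  exists eps : nat -> R,
    (eps k @[k --> \oo] --> (0 : R)) /\
    (subset_prob (1 / (k%:R `^ (r%:R - s)))
       (fun Dc : {set doc m k} =>
          (Dc != finset.set0) &&
          ((1 - eps k) * ((5 / 100) / (k%:R `^ s)) <=
             KL (ground_truth (ltnW hm) (@uniform_law R m k) Dc)
                (model_predicted (ltnW hm) (@uniform_law R m k) Dc)))
       @[k --> \oo] --> (1 : R)).
Proof.
exists (fun=> 0); split; first exact: cvg_cst.
set p := fun k : nat => 1 / (k%:R `^ (r%:R - s)).
have ky : (k%:R : R) @[k --> \oo] --> +oo by apply/cvgrnyP; exact: cvg_id.
have powy := cvgry_powR_nat (r%:R - s) ltac:(lra).
have p_le : \forall k \near \oo, 0 <= p k <= 1 / 100.
  move/cvgryPge : powy => /(_ 100); apply: filterS => k k100.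
  have k0 : 0 < k%:R `^ (r%:R - s) :> R by lra.
  by rewrite /p divr_ge0 ?(ltW k0) //= !div1r lef_pV2 ?posrE.
(* The mean number of sampled documents per first token is [k ^ s]. *)
have np (k : nat) : (0 < k)%N -> (k ^ m.-1)%:R * p k = k%:R `^ s.
  move=> k0; have kR : k%:R != 0 :> R by rewrite pnatr_eq0 -lt0n.
  rewrite -subn1 -hr natrX -powR_mulrn // /p div1r -powRN -powRD ?kR ?implybT //.
  by congr (_ `^ _); lra.
have block_card (k : nat) := card_first_token m k (ltnW hm).
pose good (k : nat) (b : R) (Dc : {set doc m k}) :=
  let c := block_count (first_token (ltnW hm)) Dc in
  (Dc != finset.set0) && (b <=
    KL (fun i => (c i)%:R / \sum_j (c j)%:R : R)
       (fun i => (0 < c i)%N%:R / \sum_j (0 < c j)%N%:R)).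
rewrite (_ : (fun k => _) = (fun k => subset_prob (p k)
    (good k (5 / 100 / k%:R `^ s)))); last first.
  apply/funext => k; apply: eq_bigl => Dc.
  by rewrite KL_first_token subr0 mul1r.
have p_le1 : \forall k \near \oo, 0 <= p k <= 1.
  by move: p_le; apply: filterS => k /andP[-> ] /=; lra.
have [s0|s0] : s = 0 \/ 0 < s by move: hs0; rewrite le_eqVlt => /orP[/eqP ->|]; [left|right].
- apply: (@squeeze_cvgr _ _ _ _ (fun k => 1 - 3 / (1 / 100 ^+ 2) ^+ 2 / k%:R) (fun=> 1)).
  + near=> k.
    have p1 : 0 <= p k <= 1 by near: k.
    have k10000 : 100 ^+ 2 <= k%:R :> R by near: k; move/cvgryPge : ky; apply.
    have k0 : (0 < k)%N by rewrite -(ltr0n R); lra.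
    have := subset_prob_sparse (p k) _ _ (block_card k).
    rewrite card_ord np // s0 powRr0 subset_prob_le1 // andbT divr1; apply => //.
    (* Blocks have size at least [k] because [m - 1 >= 1]. *)
    rewrite (le_trans k10000) // ler_nat -[leqLHS]expn1 leq_pexp2l //.
    by rewrite -ltnS prednK // ltnW.
  + rewrite -[X in _ --> X]subr0; apply: cvgB; first exact: cvg_cst.
    exact: cvg0_invr.
  + exact: cvg_cst.
- have sy := cvgry_powR_nat (s / 2) ltac:(lra).
  apply: (@squeeze_cvgr _ _ _ _
    (fun k => 1 - (2 * 100 ^+ 2 / k%:R + 100 / k%:R `^ (s / 2))) (fun=> 1)).
  + near=> k.
    have p1 : 0 <= p k <= 1 by near: k.
    have p100 : 0 <= p k <= 1 / 100 by near: k.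
    have k0 : (0 < k)%N by near: k; exact: nbhs_infty_ge.
    have L10 : 10 <= k%:R `^ (s / 2) by near: k; move/cvgryPge : sy; apply.
    (* The dense bound is applied with [L = k ^ (s / 2)], which tends to infinity since [s > 0]. *)
    have LE : k%:R `^ s = (k%:R `^ (s / 2)) ^+ 2.
      rewrite -powR_mulrn ?powR_ge0 // -powRrM; congr (_ `^ _); lra.
    have := subset_prob_dense (p k) _ _ _ (block_card k) p100 L10.
    by rewrite card_ord np // LE subset_prob_le1 // andbT; apply.
  + rewrite -[X in _ --> X]subr0 -[X in _ - X](addr0 0); apply: cvgB; first exact: cvg_cst.
    by apply: cvgD; apply: cvg0_invr.
  + exact: cvg_cst.
Unshelve. all: end_near. Qed.
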